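(* Let $n\geq1$, $d\geq 0$, let $c\in\mathsf{SortedRec}(S_{n,d})$ and let $w=\mu\circ\phi^{-1}(c)\in\mathsf{Schr\ddot{o}der}_{n,d}$. Then $\mathsf{area}(w)=\mathsf{level}(c)$ and $\mathsf{bounce}^{\mathsf{Sch}}(w)=\mathsf{wtopple}_{ITC}(c)-(n+d)$.
   Context: The complete split graph $S_{n,d}$ has vertices $s,v_1,\ldots,v_n$ and $w_1,\ldots,w_d$; any two distinct vertices among $s,v_1,\ldots,v_n$ are adjacent, each $w_j$ is adjacent to each of $s,v_1,\ldots,v_n$, and no two $w_j$'s are adjacent; $s$ is the sink, $\deg(v_i)=n+d$, $\deg(w_j)=n+1$. A configuration assigns non-negative integers to non-sink vertices, written $(c(v_1),\ldots,c(v_n);c(w_1),\ldots,c(w_d))$. A non-sink vertex $v$ is unstable if $c(v)\geq \deg(v)$; toppling $v$ removes $\deg(v)$ grains from $v$ (if $v\ne s$) and adds one grain to each non-sink neighbour. A stable configuration $c$ is recurrent iff there is an ordering $s=u_0,u_1,\ldots,u_{n+d}$ of all vertices such that starting from $c$ and toppling $u_0,\ldots,u_{i-1}$ in turn makes $u_i$ unstable for every $i\ge1$. $\mathsf{SortedRec}(S_{n,d})$: recurrent configurations with $c(v_1)\ge\cdots\ge c(v_n)$, $c(w_1)\ge\cdots\ge c(w_d)$. $\mathsf{height}(c)$ is the sum of all entries and $\mathsf{level}(c)=\mathsf{height}(c)-\left(\binom{n+d}{2}-\binom{d}{2}\right)$. ITC toppling of $c$: topple the sink; then for $i=1,2,\ldots$: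 topple simultaneously the set $Q'_i$ of currently unstable independent vertices, then topple simultaneously the set $P'_i$ of currently unstable clique vertices; stop after the first $i=k$ at which the configuration is stable. $\mathsf{wtopple}_{ITC}(c)=\sum_{i=1}^k i(|Q'_i|+|P'_i|)$. $\mathsf{Schr\ddot{o}der}_{n,d}$ is the set of words with $n$ letters $U$, $n$ letters $D$, $d$ letters $H$ such that every prefix has at most as many $D$'s as $U$'s. For such $p$, $\phi(p)=(a_1,\ldots,a_n;b_1,\ldots,b_d)$ where $b_i$ is the number of $D$'s after the $i$th $H$ and $a_j+1$ is the number of non-$U$ letters after the $j$th $U$; $\phi$ is a bijection $\mathsf{Schr\ddot{o}der}_{n,d}\to\mathsf{SortedRec}(S_{n,d})$. The mirror map is $\mu(x_1\cdots x_m)=\mu(x_m)\cdots\mu(x_1)$ with $\mu(U)=D$, $\mu(H)=H$, $\mu(D)=U$. A word $w$ is drawn as a lattice path from $(0,0)$ with $U=(0,1)$, $H=(1,1)$, $D=(1,0)$. $\mathsf{area}(w)$ is the number of triangles with vertex set $\{(i,j),(i+1,j),(i+1,j+1)\}$ ($i,j$ integers) lying between the path and the line $y=x$. Let $C(w)$ be the Dyck path from $(0,0)$ to $(n,n)$ obtained by deleting the $H$ letters. The bounce path of $C(w)$ starts at $(n,n)$ and repeats: move west until reaching the leftmost point of $C(w)$ at the current height (the top endpoint of a $U$ step of $C(w)$), then move south until reaching the line $y=x$; until $(0,0)$ is reached. $\mathrm{bounce}(C(w))$ is the sum of the $x$-coordinates of the points (other than $(n,n)$) at which the bounce path meets $y=x$.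 The $U$ steps of $C(w)$ whose top endpoints are the points where the bounce path turns from west to south correspond to $U$ steps of $w$, called the peaks of $w$. For each $H$ step $\alpha$ of $w$, $b(\alpha)$ is the number of peaks of $w$ whose top endpoint has $y$-coordinate at least the $y$-coordinate of the upper endpoint of $\alpha$. Then $\mathsf{bounce}^{\mathsf{Sch}}(w)=\mathrm{bounce}(C(w))+\sum_\alpha b(\alpha)$, the sum over all $H$ steps of $w$. *)

(* Defs.v *)
From HB Require Import structures.
From mathcomp Require Import all_boot all_order all_algebra.

Set Implicit Arguments.
Unset Strict Implicit.
Unset Printing Implicit Defensive.

(* The complete split graph S_{n,d}: [None] is the sink s, [Some (inl i)] the  *)
(* clique vertex v_{i+1} and [Some (inr j)] the independent vertex w_{j+1}.    *)

Notation nonsink n d := ('I_n + 'I_d)%type.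
Notation vertex n d := (option (nonsink n d)).

Section Sandpile.
Variables n d : nat.
Implicit Types (v : nonsink n d) (A : {set vertex n d}).

Definition independent (u : vertex n d) : bool :=
  if u is Some (inr _) then true else false.

Definition adj (u u' : vertex n d) : bool :=
  (u != u') && ~~ (independent u && independent u').

Definition deg (u : vertex n d) : nat := #|[set u' | adj u u']|.

Definition config : Type := {ffun nonsink n d -> nat}.
Implicit Types c : config.

Definition unstable c v : bool := deg (Some v) <= c v.

Definition stable c : bool := [forall v, ~~ unstable c v].

(* Simultaneous toppling of the vertices of [A]. The subtraction in [nat] is   *)
(* exact because only the sink and unstable vertices are ever toppled.         *)
Definition topple A c : config :=
  [ffun v => c v - (Some v \in A) * deg (Some v)
             + #|[set u in A | adj u (Some v)]|].

Definition topple_seq (us : seq (vertex n d)) c : config :=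
  foldl (fun c' u => topple [set u] c') c us.

Definition recurrent c : Prop :=
  stable c /\
  exists us : seq (nonsink n d),
    perm_eq us (enum {: nonsink n d}) /\
    forall us1 v us2, us = us1 ++ v :: us2 ->
      unstable (topple_seq (None :: map Some us1) c) v.

Definition sorted_rec c : Prop :=
  [/\ recurrent c,
      forall i j : 'I_n, i <= j -> c (inl j) <= c (inl i)
    & forall i j : 'I_d, i <= j -> c (inr j) <= c (inr i)].

Definition height c : nat := \sum_v c v.

Definition level c : int :=
  ((height c)%:Z - ('C(n + d, 2)%:Z - 'C(d, 2)%:Z))%R.

Definition unstable_independent c : {set vertex n d} :=
  [set Some (inr j : nonsink n d) | j : 'I_d & unstable c (inr j)].

Definition unstable_clique c : {set vertex n d} :=
  [set Some (inl i : nonsink n d) | i : 'I_n & unstable c (inl i)].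

Definition ITC_half c : config := topple (unstable_independent c) c.

Definition ITC_round c : config :=
  topple (unstable_clique (ITC_half c)) (ITC_half c).

(* The configuration after the sink and the rounds 1, ..., i have toppled.     *)
Definition ITC c (i : nat) : config := iter i ITC_round (topple [set None] c).

Definition ITC_Q c (i : nat) : {set vertex n d} :=
  unstable_independent (ITC c i.-1).

Definition ITC_P c (i : nat) : {set vertex n d} :=
  unstable_clique (ITC_half (ITC c i.-1)).

(* Every non-sink vertex is adjacent to the sink, so each of its topplings     *)
(* loses one grain.                                                            *)
Lemma height_topple A c :
    (forall u, u \in A -> exists2 v, u = Some v & unstable c v) ->
  height (topple A c) + #|A| = height c.
Proof.
move=> hA; have nA : None \notin A by apply/negP => /hA[].
have degS v : deg (Some v) = (\sum_(v' : nonsink n d) adj (Some v) (Some v')).+1.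
  rewrite -add1n /deg -sum1_card big_mkcond /=.
  rewrite (bigD1 None) //= inE {1}/adj andbF; congr addn.
  rewrite (reindex_omap Some id) /=; last by case.
  by apply: eq_big => v' *; rewrite ?eqxx // inE; case: (adj _ _).
have sumA (F : vertex n d -> nat) :
    \sum_(u in A) F u = \sum_v (Some v \in A) * F (Some v).
  rewrite (reindex_omap Some id) /=; last by case=> // /(negP nA).
  rewrite big_mkcond; apply: eq_bigr => v _ /=.
  by rewrite eqxx andbT; case: (_ \in A); rewrite ?mul1n ?mul0n.
have subA v : (Some v \in A) * deg (Some v) <= c v.
  by case: (boolP (Some v \in A)) => // /hA[_ [<-]]; rewrite mul1n.
have E : \sum_v #|[set u in A | adj u (Some v)]| + #|A|
         = \sum_v (Some v \in A) * deg (Some v).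
  under eq_bigr => v _ do rewrite cardsE -sum1_card big_mkcondr /=.
  rewrite exchange_big /= -sum1_card -big_split /= -(sumA deg).
  apply: eq_bigr => -[v|] uA; last by rewrite uA in nA.
  by rewrite degS addn1; congr _.+1; apply: eq_bigr => v' _; case: (adj _ _).
rewrite /height; under eq_bigr => v _ do rewrite ffunE.
by rewrite big_split /= -addnA E -big_split /=; apply: eq_bigr => v _; rewrite subnK.
Qed.

Lemma unstable_independentP c u :
  u \in unstable_independent c -> exists2 v, u = Some v & unstable c v.
Proof. by case/imsetP=> j; rewrite inE => uj ->; exists (inr j). Qed.

Lemma unstable_cliqueP c u :
  u \in unstable_clique c -> exists2 v, u = Some v & unstable c v.
Proof. by case/imsetP=> j; rewrite inE => uj ->; exists (inl j). Qed.

Lemma height_ITC_round c :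
  height (ITC_round c)
    + (#|unstable_independent c| + #|unstable_clique (ITC_half c)|) = height c.
Proof.
rewrite addnCA addnC (height_topple (@unstable_cliqueP (ITC_half c))).
exact: (height_topple (@unstable_independentP c)).
Qed.

Lemma ITC_round_lt c : ~~ stable c -> height (ITC_round c) < height c.
Proof.
move=> nst; rewrite -[X in _ < X]height_ITC_round -[X in X < _]addn0 ltn_add2l.
rewrite lt0n addn_eq0 !cards_eq0; apply/negP => /andP[/eqP Q0 P0].
have ch : ITC_half c = c.
  apply/ffunP => v; rewrite ffunE Q0 inE mul0n subn0.
  by rewrite (_ : [set u in set0 | _] = set0) ?cards0 ?addn0 //; apply/setP=> u; rewrite !inE.
rewrite ch in P0; case/negP: nst; apply/forallP => -[i|j]; apply/negP => un.
  by move/eqP/setP/(_ (Some (inl i))): P0; rewrite inE imset_f // inE.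
by move/setP/(_ (Some (inr j))): Q0; rewrite inE imset_f // inE.
Qed.

Lemma ITC_terminates c : exists i, (0 < i) && stable (ITC c i).
Proof.
suff [i st] : exists i, stable (iter i ITC_round (ITC c 1)).
  by exists i.+1; rewrite /ITC iterSr.
have [m] := ubnP (height (ITC c 1)); elim: m (ITC c 1) => // m IHm c1 le_m.
have [st|/ITC_round_lt lt1] := boolP (stable c1); first by exists 0.
by have [|i st] := IHm (ITC_round c1); [exact: leq_trans lt1 _ | exists i.+1; rewrite iterSr].
Qed.

Definition ITC_stop c : nat := ex_minn (ITC_terminates c).

Definition wtopple_ITC c : nat :=
  \sum_(1 <= i < (ITC_stop c).+1) i * (#|ITC_Q c i| + #|ITC_P c i|).

End Sandpile.

Inductive letter : Type := U | H | D.

Definition letter_code (x : letter) : option bool :=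
  match x with U => Some true | H => None | D => Some false end.
Definition letter_decode (o : option bool) : letter :=
  match o with Some true => U | None => H | Some false => D end.
Lemma letter_codeK : cancel letter_code letter_decode.
Proof. by case. Qed.
HB.instance Definition _ := Finite.copy letter (can_type letter_codeK).

Notation word := (seq letter).
Implicit Types (p w C : word) (x : letter).

Definition schroder (n d : nat) : pred word := fun p =>
  [&& count_mem U p == n, count_mem D p == n, count_mem H p == d &
      all (fun k => count_mem D (take k p) <= count_mem U (take k p))
          (iota 0 (size p).+1)].

(* The part of [p] strictly after its occurrence number [j] of [x], counting   *)
(* from 0.                                                                     *)
Fixpoint after x (j : nat) p : word :=
  if p is y :: q then
    if y == x then (if j is j'.+1 then after x j' q else q) else after x j q
  else [::].

(* In a Schroeder word every U is followed by at least one D, so the           *)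
(* predecessor in the clique entries is exact.                                 *)
Definition phi (n d : nat) p : config n d :=
  [ffun v : nonsink n d => match v with
    | inl j => (count (predC1 U) (after U j p)).-1
    | inr i => count_mem D (after H i p)
    end].

(* [phi n d] is a bijection from the Schroeder words onto the sorted recurrent *)
(* configurations; the value [::] outside its image is junk.                   *)
Definition phi_inv (n d : nat) (c : config n d) : word :=
  if [pick p : (n + n + d).-tuple letter
        | schroder n d p && (phi n d p == c)] is Some p then val p else [::].

Definition mirror x : letter :=
  match x with U => D | H => H | D => U end.

Definition mu w : word := rev (map mirror w).

(* The lattice point reached after the first [k] letters, with U = (0,1),      *)
(* H = (1,1) and D = (1,0).                                                    *)
Definition point w (k : nat) : nat * nat :=
  (count (predC1 U) (take k w), count (predC1 D) (take k w)).

Definition points w : seq (nat * nat) :=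
  [seq point w k | k <- iota 0 (size w).+1].

(* The triangle (i,j), (i+1,j), (i+1,j+1) lies above y = x iff its vertex      *)
(* (i+1,j) does, and it lies below the path iff its side from (i,j) to         *)
(* (i+1,j+1) lies below the step of the path from abscissa i to i+1.           *)
Definition triangle_between w (i j : nat) : bool :=
  (i.+1 <= j) &&
  [exists k : 'I_(size w),
    [&& (point w k).1 == i, (point w k.+1).1 == i.+1,
        j <= (point w k).2 & j.+1 <= (point w k.+1).2]].

(* All coordinates on the path are at most [size w], so the bounds on the      *)
(* indices lose no triangle.                                                   *)
Definition area w : nat :=
  #|[set t : 'I_(size w) * 'I_(size w) | triangle_between w t.1 t.2]|.

Definition delH w : word := [seq x <- w | x != H].

(* Abscissa of the leftmost point of [C] at height [y].                        *)
Definition leftmost C (y : nat) : nat :=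
  find (fun i => (i, y) \in points C) (iota 0 (size C).+1).

(* The heights of the successive west moves of the bounce path: it leaves the  *)
(* diagonal at (y,y), turns south at (leftmost C y, y), and is back on the     *)
(* diagonal at abscissa leftmost C y < y, so that it reaches (0,0) after at    *)
(* most n = count_mem U C such moves.                                          *)
Definition bounce_heights C : seq nat :=
  [seq y <- traject (leftmost C) (count_mem U C) (count_mem U C) | 0 < y].

Definition bounce C : nat := \sum_(y <- bounce_heights C) leftmost C y.

Definition bounce_turns C : seq (nat * nat) :=
  [seq (leftmost C y, y) | y <- bounce_heights C].

(* Steps are indexed by their position in the word; the U step of [w] at       *)
(* position [k] is the step of [delH w] at position [size (delH (take k w))].  *)
Definition peaks w : {set 'I_(size w)} :=
  [set k : 'I_(size w) | (tnth (in_tuple w) k == U) &&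
    (point (delH w) (size (delH (take k w))).+1 \in bounce_turns (delH w))].

Definition peaks_above w (k : nat) : nat :=
  #|[set l in peaks w | (point w k.+1).2 <= (point w l.+1).2]|.

Definition bounce_Sch w : nat :=
  bounce (delH w)
  + \sum_(k < size w | tnth (in_tuple w) k == H) peaks_above w k.

(* Main.v *)
Require Import Defs.
From mathcomp Require Import all_boot all_order all_algebra.
From mathcomp Require Import zify.

(** Read backwards, [phi^-1 c] becomes a word [w] in which [c(v_j) + 1] is the
    ordinate of a [D] step and [c(w_j)] the number of [U]s before an [H] step.
    For the area, a non-[U] step from abscissa [x] to a point of ordinate [y]
    has [y - x - 1] triangles below it.
    For the bounce, let [N_i] be the number of clique vertices left untoppled
    after [i] rounds. An independent vertex topples by round [i + 1] iff its [H]
    step follows the [N_i]th [U], and a clique vertex iff its [D] step does, so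
    [N_(i+1)] is the number of [D]s before the [N_i]th [U]: this is the bounce
    path. Summing the round numbers by parts, [wtopple_ITC] is the sum over [i]
    of the number of vertices untoppled after [i] rounds. The term [i = 0] is
    [n + d]; afterwards the clique vertices give [bounce] and the independent
    vertices give the peaks above the [H] steps. *)

Set Implicit Arguments.
Unset Strict Implicit.
Unset Printing Implicit Defensive.

(** * Letter counts in prefixes and sums over the steps of a word *)

Lemma leq_count_take (P : pred letter) w k l :
  k <= l -> count P (take k w) <= count P (take l w).
Proof. by move=> le_kl; rewrite -(subnKC le_kl) takeD count_cat leq_addr. Qed.

Lemma count_takeS (P : pred letter) w k : k < size w ->
  count P (take k.+1 w) = count P (take k w) + P (nth U w k).
Proof. by move=> lt_k; rewrite (take_nth U) // -cats1 count_cat /= addn0. Qed.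

(** A step in [P] strictly raises the count, so such steps are ordered by their final counts as by
    their positions. With [P] the non-[D] letters, this compares the ordinates of [U] and [H]
    steps. *)
Lemma leq_count_takeE (P : pred letter) w k l :
    k < size w -> l < size w -> P (nth U w k) -> P (nth U w l) ->
  (count P (take k.+1 w) <= count P (take l.+1 w)) = (k <= l).
Proof.
move=> lt_k lt_l Pk Pl; apply/idP/idP => [|le_kl]; last exact: leq_count_take.
apply: contraTT; rewrite -!ltnNge => lt_lk.
by rewrite (count_takeS P lt_k) Pk addn1 ltnS leq_count_take.
Qed.

(** Induction from the right suits sums over prefixes: appending a letter leaves all earlier
    prefixes unchanged. *)
Lemma sum_steps_rcons (P : pred letter) (F : word -> nat) w y :
  \sum_(k < size (rcons w y) | P (nth U (rcons w y) k)) F (take k (rcons w y))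
  = \sum_(k < size w | P (nth U w k)) F (take k w) + P y * F w.
Proof.
have take_w : take (size w) (rcons w y) = w by rewrite -cats1 take_size_cat.
rewrite size_rcons big_mkcond big_ord_recr /= nth_rcons ltnn eqxx take_w.
congr (_ + _); last first.
  by case: (P y); rewrite ?mul1n ?mul0n.
rewrite [RHS]big_mkcond; apply: eq_bigr => k _ /=.
by rewrite nth_rcons ltn_ord -cats1 takel_cat // ltnW.
Qed.

(** The [P]-step number [t], counting from 0, has exactly [t] letters of [P] before it. *)
Lemma sum_count_steps (P : pred letter) (F : nat -> nat) w :
  \sum_(k < size w | P (nth U w k)) F (count P (take k w))
  = \sum_(t < count P w) F t.
Proof.
elim/last_ind: w => [|w y IHw]; first by rewrite !big_ord0.
rewrite (sum_steps_rcons P (F \o count P)) /= IHw -cats1 count_cat /= addn0.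
by case: (P y); rewrite ?addn1 ?big_ord_recr ?mul1n // mul0n !addn0.
Qed.

(** * The mirror map and Schröder words *)

Lemma mirrorK : involutive mirror. Proof. by case. Qed.

Lemma mu_rcons w y : mu (rcons w y) = mirror y :: mu w.
Proof. by rewrite /mu map_rcons rev_rcons. Qed.

Lemma muK : involutive mu.
Proof. by move=> w; rewrite /mu map_rev revK mapK //; exact: mirrorK. Qed.

Lemma size_mu w : size (mu w) = size w.
Proof. by rewrite size_rev size_map. Qed.

Lemma count_mu (P : pred letter) w : count P (mu w) = count (P \o mirror) w.
Proof. by rewrite count_rev count_map. Qed.

(** Mirroring turns the part after an [x] into the part before a [mirror x]. Sums over the entries
    of [phi n d (mu w)] thus become sums over steps of [w]; the reversed order is invisible to a
    sum. *)
Lemma sum_after x (F : word -> nat) w :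
  \sum_(j < count_mem x (mu w)) F (after x j (mu w))
  = \sum_(k < size w | nth U w k == mirror x) F (mu (take k w)).
Proof.
elim/last_ind: w => [|w y IHw]; first by rewrite !big_ord0.
rewrite (sum_steps_rcons (pred1 (mirror x)) (F \o mu)) /= -IHw mu_rcons /=.
rewrite -(inv_eq mirrorK) /=; case: eqP => _.
  by rewrite add1n big_ord_recl mul1n addnC.
by rewrite mul0n addn0 add0n.
Qed.

Lemma schroderP n d w : reflect
  [/\ count_mem U w = n, count_mem D w = n, count_mem H w = d
    & forall k, count_mem D (take k w) <= count_mem U (take k w)]
  (schroder n d w).
Proof.
apply: (iffP and4P) => [[/eqP cU /eqP cD /eqP cH /allP pr]|[cU cD cH pr]].
  split=> // k; case: (leqP k (size w)) => [le_k|/ltnW ge_k].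
    by apply: pr; rewrite mem_iota ltnS.
  by rewrite take_oversize // cU cD.
by split; rewrite ?cU ?cD ?cH //; apply/allP => k _.
Qed.

Lemma size_count w : size w = count_mem U w + count_mem D w + count_mem H w.
Proof. by elim: w => //= -[] w ->; rewrite ?eqxx /=; lia. Qed.

Lemma count_predC1U w : count (predC1 U) w = count_mem D w + count_mem H w.
Proof. by elim: w => //= -[] w ->; rewrite /=; lia. Qed.

Lemma count_predC1D w : count (predC1 D) w = count_mem U w + count_mem H w.
Proof. by elim: w => //= -[] w ->; rewrite /=; lia. Qed.

Lemma count_U_mu w : count_mem U (mu w) = count_mem D w.
Proof. by rewrite count_mu; apply: eq_count => -[]. Qed.

Lemma count_D_mu w : count_mem D (mu w) = count_mem U w.
Proof. by rewrite count_mu; apply: eq_count => -[]. Qed.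

Lemma count_H_mu w : count_mem H (mu w) = count_mem H w.
Proof. by rewrite count_mu; apply: eq_count => -[]. Qed.

(** A prefix of [mu w] is the mirror of a suffix of [w]. Since [w] has as many [U]s as [D]s, its
    suffixes have at most as many [U]s as [D]s. *)
Lemma schroder_mu n d w : schroder n d w -> schroder n d (mu w).
Proof.
case/schroderP=> wU wD wH pr; apply/schroderP; split;
  rewrite ?count_U_mu ?count_D_mu ?count_H_mu // => k.
case: (leqP k (size w)) => [le_k|/ltnW ge_k]; last first.
  by rewrite take_oversize ?size_mu // count_U_mu count_D_mu wU wD.
have -> : take k (mu w) = mu (drop (size w - k) w).
  by rewrite /mu take_rev size_map map_drop.
rewrite count_U_mu count_D_mu.
have := pr (size w - k).
move: wU wD; rewrite -{1 2}(cat_take_drop (size w - k) w) !count_cat.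
move: (count_mem U _) (count_mem D _). lia.
Qed.

(** * Reconstructing a word from a sorted recurrent configuration *)

Lemma after_cat x j p1 p2 : count_mem x p1 <= j ->
  after x j (p1 ++ p2) = after x (j - count_mem x p1) p2.
Proof.
elim: p1 j => [|y p1 IHp] j /=; first by rewrite subn0.
case: eqP => _ /=; last by rewrite !add0n; exact: IHp.
by rewrite add1n; case: j => // j; exact: IHp.
Qed.

Lemma count_after (P : pred letter) x j p : count P (after x j p) <= count P p.
Proof.
elim: p j => //= y p IHp j.
case: eqP => _; last exact: leq_trans (IHp j) (leq_addl _ _).
by case: j => [|j]; [exact: leq_addl | exact: leq_trans (IHp j) (leq_addl _ _)].
Qed.

(** In the construction of a preimage under [phi], this shows that inserting the [U]s does not
    disturb the entries already encoded by the [H]s. *)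
Lemma after_filter x y j p : x != y ->
  [seq z <- after x j p | z != y] = after x j [seq z <- p | z != y].
Proof.
move=> xy; elim: p j => //= z p IHp j.
case: (eqVneq z x) => [->|zx] /=; first by rewrite xy /= eqxx; case: j.
by case: ifP => _ //=; rewrite (negbTE zx).
Qed.

(* The letters [x] are inserted greedily: since [s] is nonincreasing, an [x]  *)
(* goes in front of the remaining word exactly when [s] starts with its size. *)
Lemma insert_letters x (q : word) (s : seq nat) :
    x \notin q -> sorted geq s -> all (leq^~ (size q)) s ->
  exists p, [/\ [seq z <- p | z != x] = q, count_mem x p = size s
    & forall j, j < size s -> count (predC1 x) (after x j p) = nth 0 s j].
Proof.
elim: q s => [|y q IHq].
  elim=> [|a s IHs] _; first by exists [::].
  move=> /= /path_sorted s_s /andP[a0 s0].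
  have [p [fp cp ap]] := IHs isT s_s s0.
  exists (x :: p); rewrite /= eqxx /=; split; rewrite ?cp //.
  case=> [_|j] /=; last exact: ap.
  by move: a0; rewrite leqn0 => /eqP ->; rewrite -size_filter fp.
rewrite inE negb_or eq_sym => s /andP[yx xq].
elim: s => [|a s IHs] s_s s_le.
  have [p [fp cp ap]] := IHq [::] xq isT isT.
  exists (y :: p); rewrite /= yx fp (negbTE yx) cp; split=> //.
case: (ltngtP a (size q).+1) => [lt_a||eq_a].
- have [|p [fp cp ap]] := IHq (a :: s) xq s_s.
    apply/allP => b; rewrite inE => /predU1P[->|bs] //.
    have tr : transitive geq by move=> ? ? ? /= h1 h2; exact: leq_trans h2 h1.
    move: s_s; rewrite /= (path_sortedE tr) => /andP[/allP/(_ b bs) /= le_ba _].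
    by apply: leq_trans le_ba _.
  exists (y :: p); rewrite /= yx fp (negbTE yx) cp; split=> //.
- by case/andP: s_le => /= le_a _; rewrite ltnNge le_a.
have [p [fp cp ap]] := IHs (path_sorted s_s) (proj2 (andP s_le)).
exists (x :: p); rewrite /= eqxx /= cp; split=> //.
by case=> [_|j] /=; [rewrite -size_filter fp eq_a | exact: ap].
Qed.

Lemma sum_nat_pred (T : finType) (P : pred T) : \sum_x (P x : nat) = #|P|.
Proof.
rewrite -sum1_card [RHS]big_mkcond; apply: eq_bigr => x _.
by rewrite unfold_in; case: (P x).
Qed.

Lemma leq_card_ord m (S : {set 'I_m}) : #|S| <= m.
Proof. by rewrite -[leqRHS](card_ord m) max_card. Qed.

Lemma card_ord_geq n m : #|[set i : 'I_n | m <= i]| = n - m.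
Proof.
rewrite -sum1dep_card -[LHS](big_geq_mkord _ _ predT (fun=> 1)).
by rewrite sum_nat_const_nat muln1.
Qed.

Section SplitGraph.
Variables n d : nat.
Implicit Types (c : config n d) (A : {set 'I_n}) (B : {set 'I_d}).

Lemma sum_vertex (F : vertex n d -> nat) :
  \sum_u F u = F None
    + (\sum_(i < n) F (Some (inl i)) + \sum_(j < d) F (Some (inr j))).
Proof.
rewrite (bigD1 None) //= -(big_sumType _ xpredT (F \o Some)) /=.
congr (_ + _); rewrite (reindex_omap Some id) /=; last by case.
by apply: eq_big => // v; rewrite eqxx; case: v.
Qed.

Lemma deg_clique (i : 'I_n) : deg (Some (inl i) : vertex n d) = n + d.
Proof.
rewrite /deg cardsE -sum_nat_pred sum_vertex /=.
rewrite (eq_bigr (fun i' => i' \in predC1 i : nat)) => [|i' _].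
  rewrite [\sum_(j < d) _](eq_bigr (fun=> 1)) ?sum1_card ?card_ord //.
  rewrite sum_nat_pred cardC1 card_ord; have := ltn_ord i; lia.
by rewrite inE andbT /= (eq_sym i').
Qed.

Lemma deg_independent (j : 'I_d) : deg (Some (inr j) : vertex n d) = n.+1.
Proof.
rewrite /deg cardsE -sum_nat_pred sum_vertex /=.
rewrite (eq_bigr (fun=> 1)) ?sum1_card ?card_ord //.
by rewrite big1 ?addn0 // => j' _; rewrite /in_mem /= /adj andbF.
Qed.

Lemma topple_seq_notin (us : seq (vertex n d)) c v : Some v \notin us ->
  topple_seq us c v = c v + \sum_(u <- us) adj u (Some v).
Proof.
elim: us c => [|u us IHus] c; first by rewrite big_nil addn0.
rewrite inE negb_or => /andP[vu vus]; rewrite /topple_seq /= -/(topple_seq _ _).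
rewrite IHus // big_cons addnA; congr (_ + _).
rewrite ffunE inE (negbTE vu) mul0n subn0; congr (_ + _).
case: (boolP (adj u (Some v))) => uv; rewrite ?(negbTE uv) /=; last first.
  apply/eqP; rewrite cards_eq0; apply/eqP/setP => u'; rewrite !inE.
  by case: eqP => // ->; rewrite (negbTE uv).
rewrite -(cards1 u); apply: eq_card => u'; rewrite !inE.
by case: eqP => // ->; rewrite uv.
Qed.

(* Apply recurrence to the first vertex of the set [A] + [B] that topples:    *)
(* all its toppled neighbours lie outside of the set.                         *)
Lemma recurrent_first c A B : recurrent c -> 0 < #|A| + #|B| ->
  (exists2 i, i \in A & #|A| + #|B| <= (c (inl i)).+1) \/
  (exists2 j, j \in B & #|A| <= c (inr j)).
Proof.
move=> [_ [us [us_enum us_topple]]] AB0.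
pose T (v : nonsink n d) := match v with inl i => i \in A | inr j => j \in B end.
have hasT : has T us.
  have mem_us v : v \in us by rewrite (perm_mem us_enum) mem_enum.
  case: (set_0Vmem A) AB0 => [->|[i iA] _]; last by apply/hasP; exists (inl i).
  rewrite cards0; case/card_gt0P=> j jB; by apply/hasP; exists (inr j).
have Us : uniq us by rewrite (perm_uniq us_enum) enum_uniq.
case: (split_find hasT) Us us_topple => v us1 us2 Tv us1T.
rewrite cat_rcons => Us /(_ _ _ _ erefl).
move: Us; rewrite cat_uniq /= negb_or => /and3P[Us1 /andP[v_us1 _] _].
rewrite /unstable (@topple_seq_notin (None :: map Some us1)); last first.
  by rewrite inE /= mem_map // => ? ? [].
rewrite big_cons big_map big_uniq //=.
(* Every vertex toppled before [v], apart from the sink, lies outside the set. *)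
have le_adj : \sum_(u in us1) adj (Some u) (Some v)
    <= \sum_(u | ~~ T u) adj (Some u) (Some v).
  rewrite big_mkcond [leqRHS]big_mkcond; apply: leq_sum => u _.
  case: ifP => // u_us1; case: ifP => // /negbFE Tu.
  by case/negP: us1T; apply/hasP; exists u.
have lA : \sum_(i | i \notin A) 1 = n - #|A|.
  by rewrite sum1_card -[X in X - _](card_ord n) -(cardC A) addKn.
have lB : \sum_(j | j \notin B) 1 = d - #|B|.
  by rewrite sum1_card -[X in X - _](card_ord d) -(cardC B) addKn.
have leA := leq_card_ord A; have leB := leq_card_ord B.
move: (\sum_(u in us1) _) le_adj => N; rewrite big_sumType /=.
case: v Tv {v_us1} => [i|j] /= Tv le_adj.
  rewrite deg_clique => le_deg; left; exists i => //.
  have : N <= (n - #|A|) + (d - #|B|).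
    apply: leq_trans le_adj _; rewrite -lA -lB.
    by apply: leq_add; apply: leq_sum => u _; rewrite ?leq_b1.
  by move: #|A| #|B| leA leB (c _) le_deg => x y; lia.
rewrite deg_independent => le_deg; right; exists j => //.
have : N <= n - #|A|.
  apply: leq_trans le_adj _; rewrite -lA [X in _ + X]big1 ?addn0.
    by apply: leq_sum => u _; rewrite ?leq_b1.
  by move=> j' _; rewrite /adj andbF.
by move: #|A| (c _) leA le_deg => x y; lia.
Qed.

Lemma stable_clique c : stable c -> forall i, c (inl i) < n + d.
Proof.
by move=> /forallP + i => /(_ (inl i)); rewrite /unstable deg_clique -ltnNge.
Qed.

Lemma stable_independent c : stable c -> forall j, c (inr j) <= n.
Proof.
move=> /forallP + j => /(_ (inr j)).
by rewrite /unstable deg_independent -ltnNge.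
Qed.

Lemma sorted_map_enum m (f : 'I_m -> nat) :
    (forall i j : 'I_m, i <= j -> f j <= f i) ->
  sorted geq [seq f i | i <- enum 'I_m].
Proof.
move=> f_anti; rewrite sorted_map.
have : sorted ltn (map val (enum 'I_m)) by rewrite val_enum_ord iota_ltn_sorted.
rewrite sorted_map; apply: sub_sorted => i j /= lt_ij.
by apply: f_anti; exact: ltnW.
Qed.

(** The independent entries dictate where to insert the [H]s into a word of [n] letters [D]; the
    clique entries plus 1 then dictate where to insert the [U]s. Recurrence is what forces the
    prefix condition. *)
Lemma phi_surj c : sorted_rec c -> exists2 p, schroder n d p & phi n d p = c.
Proof.
case=> c_rec clique_anti indep_anti; have [c_st _] := c_rec.
have [||q [fq cq aq]] :=
  @insert_letters H (nseq n D) _ _ (sorted_map_enum indep_anti).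
- by rewrite mem_nseq andbF.
- by apply/allP => _ /mapP[j _ ->]; rewrite size_nseq; exact: stable_independent.
rewrite size_map size_enum_ord in cq aq.
have cUq : count_mem U q = 0.
  transitivity (count_mem U (nseq n D)); last by rewrite count_nseq.
  by rewrite -fq count_filter; apply: eq_count => -[].
have cDq : count_mem D q = n.
  transitivity (count_mem D (nseq n D)); last by rewrite count_nseq mul1n.
  by rewrite -fq count_filter; apply: eq_count => -[].
have [|||p [fp cp ap]] :=
  @insert_letters U q [seq (c (inl i)).+1 | i <- enum 'I_n].
- by apply/count_memPn.
- by apply: (@sorted_map_enum _ (fun i => (c (inl i)).+1)) => i j /clique_anti.
- apply/allP => _ /mapP[i _ ->]; rewrite size_count cUq cDq cq add0n.
  exact: stable_clique.
rewrite size_map size_enum_ord in cp ap.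
have cDp : count_mem D p = n.
  by rewrite -cDq -fp count_filter; apply: eq_count => -[].
have cHp : count_mem H p = d.
  by rewrite -cq -fp count_filter; apply: eq_count => -[].
have cl (i : 'I_n) : count (predC1 U) (after U i p) = (c (inl i)).+1.
  by rewrite ap // (nth_map i) ?size_enum_ord // nth_ord_enum.
have ind (j : 'I_d) : count_mem D (after H j p) = c (inr j).
  rewrite -[RHS](_ : count (predC1 H) (after H j q) = _); last first.
    by rewrite aq // (nth_map j) ?size_enum_ord // nth_ord_enum.
  by rewrite -fp -after_filter // count_filter; apply: eq_count => -[].
exists p; last by apply/ffunP => -[i|j]; rewrite ffunE ?cl ?ind.
apply/schroderP; split=> // k; rewrite leqNgt; apply/negP => lt_UD.
have cD := cDp; have cH := cHp.
rewrite -(cat_take_drop k p) count_cat in cD.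
rewrite -(cat_take_drop k p) count_cat in cH.
(* Consider the vertices whose letters lie after a prefix with too many [D]s. Their entries only
   count letters of the remaining suffix, and are too small for any of these vertices to topple
   first. *)
have [|[i]|[j]] := @recurrent_first c [set i : 'I_n | count_mem U (take k p) <= i]
    [set j : 'I_d | count_mem H (take k p) <= j] c_rec.
- rewrite !card_ord_geq; lia.
- rewrite inE !card_ord_geq => le_i.
  rewrite -cl -[X in after _ _ X](cat_take_drop k p) after_cat //.
  have := count_after (predC1 U) U (i - count_mem U (take k p)) (drop k p).
  move: (count _ (after _ _ _)); rewrite count_predC1U; lia.
rewrite inE !card_ord_geq => le_j.
rewrite -ind -[X in after _ _ X](cat_take_drop k p) after_cat //.
apply/negP; rewrite -ltnNge; apply: leq_ltn_trans (count_after _ _ _ _) _.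
move: cD lt_UD.
move: (count_mem D (drop k p)) (count_mem D (take k p)) (count_mem U _).
lia.
Qed.

End SplitGraph.

(** * Parallel toppling and the weighted number of topplings *)

Lemma sum_weighted_increments (f g : nat -> nat) m :
    (forall i, g i.+1 + f i = f i.+1) ->
  \sum_(1 <= i < m.+1) i * g i + \sum_(i < m) f i = m * f m.
Proof.
move=> fg; elim: m => [|m IHm]; first by rewrite big_geq // big_ord0.
rewrite big_nat_recr //= big_ord_recr /= -fg; move: IHm; rewrite mulnDr.
move: (bigop _ _ _) (bigop _ _ _); lia.
Qed.

Section ParallelToppling.
Variables n d : nat.
Implicit Types (c : config n d) (A : {set 'I_n}) (B : {set 'I_d}).

Lemma in_unstable_independent c (j : 'I_d) :
  (Some (inr j) \in unstable_independent c) = unstable c (inr j).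
Proof.
apply/imsetP/idP => [[j']|un]; first by rewrite inE => un [->].
by exists j => //; rewrite inE.
Qed.

Lemma clique_notin_unstable_independent c (i : 'I_n) :
  (Some (inl i) \in unstable_independent c) = false.
Proof. by apply/negP => /imsetP[]. Qed.

Lemma in_unstable_clique c (i : 'I_n) :
  (Some (inl i) \in unstable_clique c) = unstable c (inl i).
Proof.
apply/imsetP/idP => [[i']|un]; first by rewrite inE => un [->].
by exists i => //; rewrite inE.
Qed.

Lemma independent_notin_unstable_clique c (j : 'I_d) :
  (Some (inr j) \in unstable_clique c) = false.
Proof. by apply/negP => /imsetP[]. Qed.

Lemma card_unstable_independent c :
  #|unstable_independent c| = #|[set j : 'I_d | unstable c (inr j)]|.
Proof. by rewrite card_imset // => ? ? []. Qed.

Lemma card_unstable_clique c :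
  #|unstable_clique c| = #|[set i : 'I_n | unstable c (inl i)]|.
Proof. by rewrite card_imset // => ? ? []. Qed.

(* [toppled c c' A B]: [c'] is obtained from [c] by toppling once the sink and *)
(* the vertices of [A] and [B]; the extra 1 compensates for the grain that a   *)
(* clique vertex of [A] does not send to itself.                               *)
Definition toppled c c' A B : Prop :=
  (forall i, c' (inl i) + (i \in A) * (n + d).+1 = (c (inl i)).+1 + #|A| + #|B|)
  /\ (forall j, c' (inr j) + (j \in B) * n.+1 = (c (inr j)).+1 + #|A|).

(** No vertex becomes unstable twice: a clique vertex of [A] starts with fewer than [n + d] grains
    and receives at most [n + d], in total less than twice its degree. *)
Lemma toppled_unstable_clique c c' A B i : stable c -> toppled c c' A B ->
  unstable c' (inl i)
  = (i \notin A) && (n + d <= (c (inl i)).+1 + #|A| + #|B|).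
Proof.
move=> /stable_clique/(_ i) c_i [/(_ i) c'_i _]; rewrite /unstable deg_clique.
have := leq_card_ord A; have := leq_card_ord B.
move: c'_i c_i; move: #|A| #|B| (c (inl i)) (c' _) => a b x y.
case: (i \in A); lia.
Qed.

Lemma toppled_unstable_independent c c' A B j : stable c -> toppled c c' A B ->
  unstable c' (inr j) = (j \notin B) && (n <= c (inr j) + #|A|).
Proof.
move=> /stable_independent/(_ j) c_j [_ /(_ j) c'_j].
rewrite /unstable deg_independent; have := leq_card_ord A.
move: c'_j c_j; move: #|A| (c (inr j)) (c' _) => a x y.
case: (j \in B); lia.
Qed.

(** The unstable independent vertices are exactly those of [B'] outside [B], so toppling them
    enlarges [B] to [B']. *)
Lemma toppled_half c c' A B B' : stable c -> toppled c c' A B ->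
    B' = [set j | n <= c (inr j) + #|A|] -> B \subset B' ->
  #|unstable_independent c'| + #|B| = #|B'| /\ toppled c (ITC_half c') A B'.
Proof.
move=> c_st c'_top B'E sBB'.
have un j : unstable c' (inr j) = (j \in B') && (j \notin B).
  by rewrite (toppled_unstable_independent j c_st c'_top) B'E inE andbC.
have cardB' : #|unstable_independent c'| + #|B| = #|B'|.
  rewrite card_unstable_independent -(cardsID B B') (setIidPr sBB') addnC.
  by congr (_ + _); apply: eq_card => j; rewrite !inE un andbC.
split=> //; case: c'_top => c'_cl c'_in; split=> [i|j]; rewrite ffunE.
  rewrite clique_notin_unstable_independent mul0n subn0.
  rewrite (_ : [set u in _ | _] = unstable_independent c').
    by move: cardB' (c'_cl i); lia.
  apply/setP => u; rewrite inE; case: imsetP => //= -[j _ ->].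
  by rewrite /adj.
rewrite in_unstable_independent un deg_independent.
rewrite (_ : [set u in _ | _] = set0) ?cards0 ?addn0; last first.
  apply/setP => u; rewrite !inE; case: imsetP => //= -[j' _ ->].
  by rewrite /adj andbF.
have := c'_in j; have := un j; rewrite /unstable deg_independent.
have := subsetP sBB' j.
move: (c' _) (c _) #|A| => x y a.
case: (j \in B'); case: (j \in B) => //=; lia.
Qed.

Lemma toppled_full c c' A B A' : stable c -> toppled c c' A B ->
    A' = [set i | n + d <= (c (inl i)).+1 + #|A| + #|B|] -> A \subset A' ->
  #|unstable_clique c'| + #|A| = #|A'|
  /\ toppled c (topple (unstable_clique c') c') A' B.
Proof.
move=> c_st c'_top A'E sAA'.
have un i : unstable c' (inl i) = (i \in A') && (i \notin A).
  by rewrite (toppled_unstable_clique i c_st c'_top) A'E inE andbC.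
have cardA' : #|unstable_clique c'| + #|A| = #|A'|.
  rewrite card_unstable_clique -(cardsID A A') (setIidPr sAA') addnC.
  by congr (_ + _); apply: eq_card => i; rewrite !inE un andbC.
split=> //; case: c'_top => c'_cl c'_in; split=> [i|j]; rewrite ffunE.
  (* A vertex sends no grain to itself; [cardsD1] accounts for the missing one, in agreement with
     the extra 1 in [toppled]. *)
  rewrite (_ : [set u in _ | _] = unstable_clique c' :\ Some (inl i)).
    have := cardsD1 (Some (inl i)) (unstable_clique c').
    rewrite in_unstable_clique un deg_clique => card1.
    have := c'_cl i; have := un i; rewrite /unstable deg_clique.
    have := subsetP sAA' i; move: card1 cardA'.
    move: (c' _) (c _) #|A| #|A'| #|B| #|_ :\ _|.
    move: #|unstable_clique _| => t x y a a' b s.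
    case: (i \in A'); case: (i \in A) => //=; lia.
  apply/setP => u; rewrite !inE; case: imsetP => [[i' _ ->]|_].
    by rewrite /adj /= !andbT.
  by rewrite andbF.
rewrite independent_notin_unstable_clique mul0n subn0.
rewrite (_ : [set u in _ | _] = unstable_clique c').
  by move: cardA' (c'_in j); lia.
apply/setP => u; rewrite inE; case: imsetP => //= -[i _ ->].
by rewrite /adj.
Qed.

Lemma topple0 c : topple set0 c = c.
Proof.
apply/ffunP => v; rewrite ffunE inE mul0n subn0.
rewrite (_ : [set u in set0 | _] = set0) ?cards0 ?addn0 //.
by apply/setP => u; rewrite !inE.
Qed.

Lemma stable_ITC_round c : stable c ->
  [/\ unstable_independent c = set0, unstable_clique (ITC_half c) = set0
    & ITC_round c = c].
Proof.
move=> /forallP c_st.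
have Q0 : unstable_independent c = set0.
  apply/setP => u; rewrite inE; apply/negP => /unstable_independentP[v _].
  exact/negP.
have hc : ITC_half c = c by rewrite /ITC_half Q0 topple0.
have P0 : unstable_clique c = set0.
  apply/setP => u; rewrite inE; apply/negP => /unstable_cliqueP[v _].
  exact/negP.
by rewrite /ITC_round hc P0 topple0.
Qed.

(** A stable configuration is fixed by further rounds, which topple nothing. Hence any stable round
    can replace the minimal one as the upper bound. *)
Lemma wtopple_ITC_extend c m : 0 < m -> stable (ITC c m) ->
  wtopple_ITC c = \sum_(1 <= i < m.+1) i * (#|ITC_Q c i| + #|ITC_P c i|).
Proof.
move=> m0 st_m; rewrite /wtopple_ITC /ITC_stop.
case: ex_minnP => k /andP[k0 st_k] /(_ m); rewrite m0 st_m => /(_ isT) le_km.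
have ITC_k i : k <= i -> ITC c i = ITC c k.
  move=> /subnK <-; elim: (i - k) => // j IHj.
  rewrite addSn [LHS]iterS -/(ITC c _) IHj.
  by case: (stable_ITC_round st_k).
rewrite [RHS](big_cat_nat (n := k.+1)) //= -[LHS]addn0; congr (_ + _).
apply/esym; rewrite big_nat big1 //.
case=> // i /andP[le_ki _]; rewrite /ITC_Q /ITC_P /= ITC_k //.
by case: (stable_ITC_round st_k) => -> -> _; rewrite !cards0 muln0.
Qed.

(* [N i] and [M i] are the numbers of clique and of independent vertices that *)
(* have not toppled after [i] rounds.                                         *)
Lemma wtopple_ITC_sum c (N M : nat -> nat) m : stable c ->
    N 0 = n -> M 0 = d ->
    (forall i, M i.+1 = #|[set j | c (inr j) < N i]|) ->
    (forall i, N i.+1 = #|[set k | (c (inl k)).+1 < N i + M i.+1]|) ->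
    0 < m -> N m = 0 -> M m = 0 ->
  wtopple_ITC c = \sum_(i < m) (N i + M i).
Proof.
move=> c_st N0 M0 MS NS m0 Nm Mm.
have M_d : forall i, M i <= d by case=> [|i]; rewrite ?M0 // MS leq_card_ord.
have N_n : forall i, N i <= n by case=> [|i]; rewrite ?N0 // NS leq_card_ord.
(* Both recurrences are monotone, so a decrease propagates to the next round; [M] comes first
   because [N] uses its new value. *)
have anti i : N i.+1 <= N i /\ M i.+1 <= M i.
  elim: i => [|i [le_N le_M]]; first by rewrite N0 M0.
  have le_M' : M i.+2 <= M i.+1.
    rewrite !MS; apply/subset_leq_card/subsetP => j; rewrite !inE => lt_j.
    exact: leq_trans lt_j le_N.
  split=> //; rewrite NS [leqRHS]NS; apply/subset_leq_card/subsetP => j.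
  by rewrite !inE => /leq_trans-> //; apply: leq_add.
(* The vertices toppled during the first [i] rounds, as complements of the sets counted by [M i] and
   [N i]; [top] below confirms this. *)
pose B i := if i is i'.+1 then [set j | N i' <= c (inr j)] else set0.
pose A i := if i is i'.+1 then [set k | N i' + M i <= (c (inl k)).+1] else set0.
have cB i : #|B i| + M i = d.
  case: i => [|i]; first by rewrite cards0 M0.
  rewrite MS -[RHS](card_ord d) -[RHS](cardC (B i.+1)); congr (_ + _).
  by apply: eq_card => j; rewrite !inE -ltnNge.
have cA i : #|A i| + N i = n.
  case: i => [|i]; first by rewrite cards0 N0.
  rewrite NS -[RHS](card_ord n) -[RHS](cardC (A i.+1)); congr (_ + _).
  by apply: eq_card => j; rewrite !inE -ltnNge.
have sB i : B i \subset B i.+1.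
  case: i => [|i]; first exact: sub0set.
  by apply/subsetP => j; rewrite !inE; apply: leq_trans; case: (anti i).
have sA i : A i \subset A i.+1.
  case: i => [|i]; first exact: sub0set.
  apply/subsetP => j; rewrite !inE; apply: leq_trans.
  by apply: leq_add; [case: (anti i) | case: (anti i.+1)].
have BS i : B i.+1 = [set j | n <= c (inr j) + #|A i|].
  by apply/setP => j; rewrite !inE; move: #|A i| (c _) (cA i); lia.
have AS i : A i.+1 = [set k | n + d <= (c (inl k)).+1 + #|A i| + #|B i.+1|].
  apply/setP => k; rewrite !inE; move: (cA i) (cB i.+1).
  move: #|A i| #|B _| (c _); lia.
have top i : toppled c (ITC c i) (A i) (B i).
  elim: i => [|i IHi].
    split=> [k|j]; rewrite !cards0 inE mul0n !addn0 ffunE inE mul0n subn0 -addn1.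
      congr (_ + _); rewrite -(cards1 (None : vertex n d)); apply: eq_card => u.
      by rewrite !inE; case: eqP => // ->.
    congr (_ + _); rewrite -(cards1 (None : vertex n d)); apply: eq_card => u.
    by rewrite !inE; case: eqP => // ->.
  have [_ topB] := toppled_half c_st IHi (BS i) (sB i).
  by have [_ topA] := toppled_full c_st topB (AS i) (sA i).
have cardQP i : (#|ITC_Q c i.+1| + #|ITC_P c i.+1|) + (#|A i| + #|B i|)
    = #|A i.+1| + #|B i.+1|.
  rewrite /ITC_Q /ITC_P /=.
  have [cQ topB] := toppled_half c_st (top i) (BS i) (sB i).
  have [cP _] := toppled_full c_st topB (AS i) (sA i).
  by rewrite -cP -cQ [X in X + _]addnC addnACA.
have st_m : stable (ITC c m).
  apply/forallP => -[k|j].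
    rewrite (toppled_unstable_clique k c_st (top m)).
    suff -> : A m = setT by rewrite inE.
    by apply/eqP; rewrite eqEcard subsetT cardsT card_ord -[leqLHS](cA m) Nm addn0 /=.
  rewrite (toppled_unstable_independent j c_st (top m)).
  suff -> : B m = setT by rewrite inE.
  by apply/eqP; rewrite eqEcard subsetT cardsT card_ord -[leqLHS](cB m) Mm addn0 /=.
rewrite (wtopple_ITC_extend m0 st_m).
have := @sum_weighted_increments (fun i => #|A i| + #|B i|)
  (fun i => #|ITC_Q c i| + #|ITC_P c i|) m cardQP.
(* After [m] rounds everything has toppled. At each earlier [i] the same [n + d] vertices split into
   toppled and untoppled ones, so cancelling the toppled ones in the summation by parts leaves the
   claim. *)
have -> : m * (#|A m| + #|B m|) =
    \sum_(i < m) (N i + M i) + \sum_(i < m) (#|A i| + #|B i|).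
  rewrite -big_split /= -[X in X * _](card_ord m) -sum_nat_const.
  apply: eq_bigr => i _.
  move: #|A m| #|B m| #|A i| #|B i| (cA m) (cB m) (cA i) (cB i).
  by rewrite Nm Mm; lia.
by move/addIn.
Qed.

End ParallelToppling.

(** * Bounce paths, and auxiliary finite sums *)

Lemma traject_iota (T : Type) (f : T -> T) x m :
  traject f x m = [seq iter i f x | i <- iota 0 m].
Proof.
apply: (@eq_from_nth _ x) => [|i]; rewrite size_traject ?size_map ?size_iota //.
by move=> lt_im; rewrite nth_traject // (nth_map 0) ?size_iota // nth_iota.
Qed.

Lemma find_iota (a : pred nat) i m :
  i < m -> a i -> (forall j, a j -> i <= j) -> find a (iota 0 m) = i.
Proof.
move=> lt_im ai min_i; apply/eqP; rewrite eqn_leq.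
have a_has : has a (iota 0 m) by apply/hasP; exists i; rewrite ?mem_iota.
have lt_f : find a (iota 0 m) < m by rewrite -[ltnRHS](size_iota 0) -has_find.
have := nth_find 0 a_has; rewrite nth_iota // add0n => /min_i ->.
rewrite andbT leqNgt; apply/negP => lt_if.
have := before_find 0 lt_if; by rewrite nth_iota // add0n ai.
Qed.

Lemma point_after_U w1 w2 : point (w1 ++ U :: w2) (size w1).+1
  = (count (predC1 U) w1, (count (predC1 D) w1).+1).
Proof.
rewrite /point -cat_rcons -(size_rcons w1 U) take_size_cat //.
by rewrite -cats1 !count_cat /= !addn0 addn1.
Qed.

(** Points before the end of this [U] step are strictly lower, and abscissas never decrease
    afterwards. *)
Lemma leftmost_after_U w1 w2 :
  leftmost (w1 ++ U :: w2) (count (predC1 D) w1).+1 = count (predC1 U) w1.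
Proof.
apply: find_iota.
- rewrite ltnS size_cat; exact: leq_trans (count_size _ _) (leq_addr _ _).
- apply/mapP; exists (size w1).+1; last by rewrite point_after_U.
  by rewrite mem_iota size_cat /= add0n ltnS addnS ltnS leq_addr.
move=> i /mapP[k _ [-> y_k]].
have lt_k : size w1 < k.
  rewrite ltnNge; apply/negP => le_k; move: y_k; rewrite takel_cat //.
  have := leq_count_take (predC1 D) w1 le_k; rewrite take_size.
  by move=> le_c eq_c; rewrite -eq_c ltnn in le_c.
rewrite -{1}(take_size_cat (U :: w2) (erefl (size w1))).
exact/leq_count_take/ltnW.
Qed.

(** The origin is a fixed point, so iterating past the end of the bounce path is harmless. *)
Lemma leftmost0 w : leftmost w 0 = 0.
Proof.
by apply: find_iota => //; apply/mapP; exists 0; rewrite // /point take0.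
Qed.

Lemma delH_cat w1 w2 : delH (w1 ++ w2) = delH w1 ++ delH w2.
Proof. exact: filter_cat. Qed.

Lemma count_predC1U_delH w : count (predC1 U) (delH w) = count_mem D w.
Proof. by rewrite count_filter; apply: eq_count => -[]. Qed.

Lemma count_predC1D_delH w : count (predC1 D) (delH w) = count_mem U w.
Proof. by rewrite count_filter; apply: eq_count => -[]. Qed.

Lemma leftmost_delH w1 w2 :
  leftmost (delH (w1 ++ U :: w2)) (count_mem U w1).+1 = count_mem D w1.
Proof.
by rewrite delH_cat -count_predC1D_delH -count_predC1U_delH leftmost_after_U.
Qed.

Lemma split_letter (x : letter) (w : word) t : t < count_mem x w ->
  exists w1 w2, w = w1 ++ x :: w2 /\ count_mem x w1 = t.
Proof.
elim: w t => //= y w IHw t; case: (eqVneq y x) => [->|yx] /=.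
  case: t => [|t lt_t]; first by exists [::], w.
  have [w1 [w2 [-> <-]]] := IHw t lt_t; exists (x :: w1), w2.
  by rewrite /= eqxx.
move=> /IHw[w1 [w2 [-> <-]]]; exists (y :: w1), w2.
by rewrite /= (negbTE yx).
Qed.

(** The letter [u] is itself in [P], so every prefix reaching past it exceeds [count P w1]: the
    bound singles out the positions up to [u], and [u] is not in [Q]. *)
Lemma sum_steps_before (P Q : pred letter) w1 u w2 : P u -> ~~ Q u ->
  \sum_(k < size (w1 ++ u :: w2) | Q (nth U (w1 ++ u :: w2) k))
    (count P (take k (w1 ++ u :: w2)) <= count P w1) = count Q w1.
Proof.
move=> Pu /negbTE Qu; pose F q : nat := count P q <= count P w1.
elim/last_ind: w2 => [|w2 y IHw2].
  rewrite cats1 (sum_steps_rcons Q F) Qu mul0n addn0.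
  rewrite -[RHS]card_ord -sum1_card -(sum_count_steps Q (fun=> 1)).
  apply: eq_bigr => k _; rewrite /F -[X in _ <= count P X]take_size.
  by rewrite leq_count_take // ltnW.
rewrite -rcons_cons -rcons_cat (sum_steps_rcons Q F) IHw2 /F count_cat /= Pu.
by rewrite -[leqRHS]addn0 leq_add2l muln0 addn0.
Qed.

(** The [U] step number [t], counting from 0, rises to height [t.+1] once the [H]s are deleted. This
    turns a count of bounce heights into one of [U] steps. *)
Lemma sum_mem_count (s : seq nat) (Q : pred nat) n :
    uniq s -> (forall y, y \in s -> 0 < y <= n) ->
  \sum_(t < n) ((t.+1 \in s) && Q t.+1) = count Q s.
Proof.
move=> s_uniq s_range.
rewrite -(big_mkord xpredT (fun t => (t.+1 \in s) && Q t.+1 : nat)).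
rewrite /index_iota subn0 -(big_map succn xpredT (fun y => (y \in s) && Q y : nat)).
rewrite (_ : map _ _ = iota 1 n); last by rewrite -(iotaDl 1 0).
rewrite -sum1_count -(big_filter s Q).
have eq_s : perm_eq [seq y <- iota 1 n | (y \in s) && Q y] [seq y <- s | Q y].
  apply: uniq_perm; rewrite ?filter_uniq ?iota_uniq // => y.
  rewrite !mem_filter mem_iota add1n ltnS; case: (boolP (y \in s)) => [ys|//].
    by rewrite s_range // andbT.
  by rewrite !andbF.
rewrite -(perm_big _ eq_s) big_filter [RHS]big_mkcond /=; apply: eq_bigr => y _.
by case: (_ && _).
Qed.

Lemma sum_exists_unique (T : finType) (P : pred T) :
  (forall x y, P x -> P y -> x = y) -> [exists x, P x] = \sum_x P x :> nat.
Proof.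
move=> P_inj; case: existsP => [[x Px]|nP].
  rewrite (bigD1 x) //= Px big1 // => y y_x.
  by case: (boolP (P y)) => // /P_inj/(_ Px) yx; rewrite yx eqxx in y_x.
by rewrite big1 // => x _; case: (boolP (P x)) => // Px; case: nP; exists x.
Qed.

Lemma sum_ord_interval m a b : b <= m -> \sum_(j < m) (a <= j < b) = b - a.
Proof.
move=> le_bm; rewrite -(big_mkord xpredT (fun j => a <= j < b : nat)).
elim: m b le_bm => [|m IHm] b; first by rewrite leqn0 => /eqP->; rewrite big_geq.
rewrite leq_eqVlt big_nat_recr //= => /predU1P[->|]; last first.
  by rewrite ltnS => le_bm; rewrite IHm // ltnNge le_bm andbF addn0.
have -> : \sum_(0 <= j < m) (a <= j < m.+1) = \sum_(0 <= j < m) (a <= j < m).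
  by apply: eq_big_nat => j /andP[_ lt_jm]; rewrite ltnS (ltnW lt_jm) lt_jm.
rewrite IHm // ltnSn andbT; case: leqP; lia.
Qed.

(** * Toppling, bounce and area read off a Schröder word *)

Section Schroder.
Variables (n d : nat) (w : word).
Hypothesis w_schroder : schroder n d w.

Let cU : count_mem U w = n. Proof. by case/schroderP: w_schroder. Qed.
Let cD : count_mem D w = n. Proof. by case/schroderP: w_schroder. Qed.
Let cH : count_mem H w = d. Proof. by case/schroderP: w_schroder. Qed.
Let cprefix k : count_mem D (take k w) <= count_mem U (take k w).
Proof. by case/schroderP: w_schroder. Qed.

Let c : config n d := phi n d (mu w).

Lemma sum_clique (F : nat -> nat) : \sum_(i < n) F (c (inl i)).+1
  = \sum_(k < size w | nth U w k == D) F (count (predC1 D) (take k w)).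
Proof.
have := @sum_after U (fun q => F (count (predC1 U) q).-1.+1) w.
rewrite count_U_mu cD => sumE.
transitivity (\sum_(i < n) F (count (predC1 U) (after U i (mu w))).-1.+1).
  by apply: eq_bigr => i _; rewrite ffunE.
rewrite sumE; apply: eq_bigr => k /eqP w_k; congr (F _).
rewrite count_mu (@eq_count _ _ (predC1 D)) => [|[]//]; rewrite prednK //.
(* The prefix condition at this [D] step puts a [U] before it, so the truncated predecessor in [phi]
   is exact. *)
have := cprefix k.+1; rewrite !count_takeS // w_k /= addn0 addn1.
move/(leq_trans (ltn0Sn _))/leq_trans; apply.
by apply: sub_count => -[].
Qed.

Lemma sum_independent (F : nat -> nat) : \sum_(j < d) F (c (inr j))
  = \sum_(k < size w | nth U w k == H) F (count_mem U (take k w)).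
Proof.
have := @sum_after H (fun q => F (count_mem D q)) w.
rewrite count_H_mu cH => sumE.
transitivity (\sum_(j < d) F (count_mem D (after H j (mu w)))).
  by apply: eq_bigr => i _; rewrite ffunE.
by rewrite sumE; apply: eq_bigr => k _; rewrite count_D_mu.
Qed.

Local Notation L := (leftmost (delH w)).

(** Only [y - 1] letters [U] precede the [y]th one, hence at most [y - 1] letters [D]. *)
Lemma leftmost_lt y : 0 < y <= n -> L y < y.
Proof.
case: y => // t /=; rewrite -cU => /split_letter[w1 [w2 [wE <-]]].
rewrite {1}wE leftmost_delH ltnS.
by have := cprefix (size w1); rewrite wE take_size_cat.
Qed.

Lemma card_independent_lt y :
  #|[set j : 'I_d | c (inr j) < y]|
  = \sum_(k < size w | nth U w k == H) (count_mem U (take k w) < y).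
Proof.
by rewrite cardsE -sum_nat_pred (sum_independent (fun b => b < y)).
Qed.

(** One move of the bounce path is one round of toppling. For [y > 0] the inner cardinal counts the
    [H]s before the [y]th [U], so adding [y] gives the ordinate in [w] of the top of that [U]; the
    [D] steps of smaller ordinate are those before it. *)
Lemma leftmost_card_clique y : y <= n ->
  L y = #|[set i : 'I_n
           | (c (inl i)).+1 < y + #|[set j : 'I_d | c (inr j) < y]|]|.
Proof.
set M := #|[set j : 'I_d | _]|; case: y @M => [|t] M le_t.
  have M0 : M = 0.
    by apply/eqP; rewrite cards_eq0; apply/eqP/setP => j; rewrite !inE.
  rewrite leftmost0 M0; apply/esym/eqP; rewrite cards_eq0.
  by apply/eqP/setP => i; rewrite !inE.
rewrite cardsE -sum_nat_pred (sum_clique (fun a => a < t.+1 + M)).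
move: le_t; rewrite -cU => /split_letter[w1 [w2 [wE tE]]].
have ME : M = count_mem H w1.
  rewrite /M card_independent_lt wE -tE.
  exact: (@sum_steps_before (pred1 U) (pred1 H)).
have -> : t.+1 + M = (count (predC1 D) w1).+1.
  by rewrite addSn ME -tE count_predC1D.
rewrite {1}wE -tE leftmost_delH wE.
by rewrite -[LHS](@sum_steps_before (predC1 D) (pred1 D) w1 U w2).
Qed.

Let N i := iter i L n.

Lemma iter_leftmost_le i : N i <= n - i.
Proof.
elim: i => [|i IHi]; first by rewrite subn0.
rewrite /N iterS -/(N i); case: (posnP (N i)) => [->|Ni_gt0].
  by rewrite leftmost0.
have := @leftmost_lt (N i); rewrite Ni_gt0 (leq_trans IHi) ?leq_subr //.
by move=> /(_ isT); move: IHi; lia.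
Qed.

Lemma wtopple_ITC_word : stable c ->
  wtopple_ITC c = n + d + (\sum_(i < n) L (N i)
    + \sum_(i < n) \sum_(k < size w | nth U w k == H)
        (count_mem U (take k w) < N i)).
Proof.
move=> c_st.
pose M i := if i is i'.+1 then #|[set j : 'I_d | c (inr j) < N i']| else d.
(* The iterate [N n] is 0, but [M] lags one round behind and is only sure to vanish at [n.+1]. The
   term of index 0 is [n + d]. *)
rewrite (@wtopple_ITC_sum _ _ c N M n.+1) //.
- rewrite big_ord_recl /= -big_split; congr (_ + _).
  by apply: eq_bigr => i _; rewrite /= card_independent_lt.
- move=> i; rewrite [LHS]leftmost_card_clique //.
  exact: leq_trans (iter_leftmost_le i) (leq_subr _ _).
- by have := iter_leftmost_le n.+1; lia.
have N0 : N n = 0 by have := iter_leftmost_le n; lia.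
apply/eqP; rewrite cards_eq0 N0; apply/eqP/setP => j; rewrite !inE.
by [].
Qed.

Lemma bounce_heightsE :
  bounce_heights (delH w) = [seq y <- [seq N i | i <- iota 0 n] | 0 < y].
Proof.
rewrite /bounce_heights count_filter (@eq_count _ _ (pred1 (U : letter))) => [|[]//].
by rewrite cU traject_iota.
Qed.

(** The zero iterates missing from [bounce_heights] are rejected by [P], so the sum may run over all
    [i < n]. *)
Lemma sum_bounce_heights (P : pred nat) (F : nat -> nat) :
    (forall y, P y -> 0 < y) ->
  \sum_(y <- bounce_heights (delH w) | P y) F y
  = \sum_(i < n) (if P (N i) then F (N i) else 0).
Proof.
move=> P_gt0; rewrite bounce_heightsE big_filter_cond big_map big_mkcond /=.
rewrite -[RHS](big_mkord xpredT (fun i => if P (N i) then F (N i) else 0)).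
rewrite /index_iota subn0; apply: eq_bigr => i _.
by case: (boolP (P _)) => [/P_gt0->|]; rewrite ?andbF.
Qed.

Lemma iter_leftmost_lt i j : i < j -> 0 < N j -> N j < N i.
Proof.
elim: j => // j IHj; rewrite ltnS /N iterS -/(N j).
case: (posnP (N j)) => [->|Nj_gt0]; first by rewrite leftmost0.
have lt_Nj : L (N j) < N j.
  by rewrite leftmost_lt // Nj_gt0 (leq_trans (iter_leftmost_le j)) ?leq_subr.
rewrite leq_eqVlt => /predU1P[-> //|/IHj/(_ Nj_gt0) lt_ij _].
exact: ltn_trans lt_ij.
Qed.

Lemma bounce_heights_uniq : uniq (bounce_heights (delH w)).
Proof.
rewrite bounce_heightsE filter_map map_inj_in_uniq ?filter_uniq ?iota_uniq //.
move=> i j; rewrite !mem_filter /= => /andP[Ni _] /andP[Nj _] eq_ij.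
by case: (ltngtP i j) => // /iter_leftmost_lt; rewrite eq_ij ltnn => /(_ Nj).
Qed.

Lemma bounce_heights_range y : y \in bounce_heights (delH w) -> 0 < y <= n.
Proof.
rewrite bounce_heightsE mem_filter => /andP[-> /mapP[i _ ->]].
exact: leq_trans (iter_leftmost_le i) (leq_subr _ _).
Qed.

(** The top of a [U] step of the Dyck path is the leftmost point at its height, so its height alone
    tells whether the bounce path turns there. *)
Lemma mem_peaks (l : 'I_(size w)) : (l \in peaks w) =
  (nth U w l == U) && ((count_mem U (take l w)).+1 \in bounce_heights (delH w)).
Proof.
rewrite inE (tnth_nth U) /=; case: (eqVneq (nth U w l) U) => //= w_l.
have wE : w = take l w ++ U :: drop l.+1 w.
  by rewrite -[U in RHS]w_l -drop_nth // cat_take_drop.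
rewrite {1}wE delH_cat point_after_U count_predC1U_delH count_predC1D_delH.
apply/mapP/idP => [[y hy [_ ->]] //|hy]; exists (count_mem U (take l w)).+1 => //.
by rewrite [in delH w]wE leftmost_delH.
Qed.

(** Both [U] and [H] raise the ordinate, so a peak is at least as high as an [H] step exactly when
    it comes later, that is, when its bounce height exceeds the number of [U]s before the [H]. *)
Lemma peaks_above_H (k : 'I_(size w)) : nth U w k = H -> peaks_above w k
  = count (fun y => count_mem U (take k w) < y) (bounce_heights (delH w)).
Proof.
move=> w_k; rewrite /peaks_above -sum1dep_card.
rewrite -(@sum_mem_count _ _ n bounce_heights_uniq bounce_heights_range) -cU.
rewrite -(sum_count_steps (pred1 U) (fun t => (t.+1 \in bounce_heights (delH w))
  && (count_mem U (take k w) < t.+1) : nat)) /=.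
rewrite big_mkcond [RHS]big_mkcond; apply: eq_bigr => l _.
rewrite mem_peaks; case: (eqVneq (nth U w l) U) => //= w_l.
rewrite /point /= leq_count_takeE ?w_k ?w_l //.
have -> : (count_mem U (take k w) < (count_mem U (take l w)).+1) = (k <= l).
  rewrite ltnS; apply/idP/idP => [|/leq_count_take->//].
  apply: contraTT; rewrite -!ltnNge => lt_lk.
  apply: leq_trans (leq_count_take (pred1 U) w lt_lk).
  by rewrite count_takeS // w_l /= addn1.
by case: (_ && _).
Qed.

Lemma bounce_Sch_word : bounce_Sch w = \sum_(i < n) L (N i)
  + \sum_(i < n) \sum_(k < size w | nth U w k == H)
      (count_mem U (take k w) < N i).
Proof.
rewrite /bounce_Sch; congr (_ + _).
  transitivity (\sum_(y <- bounce_heights (delH w) | 0 < y) L y).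
    rewrite [LHS]big_seq [RHS]big_seq_cond; apply: eq_bigl => y.
    by case: (boolP (_ \in _)) => //= /bounce_heights_range/andP[->].
  rewrite sum_bounce_heights //; apply: eq_bigr => i _.
  by case: posnP => // ->; rewrite leftmost0.
rewrite exchange_big /=; apply: eq_big => k; first by rewrite (tnth_nth U).
rewrite (tnth_nth U) => /eqP w_k; rewrite peaks_above_H // -sum1_count.
rewrite sum_bounce_heights => [|y]; last exact: leq_ltn_trans.
by apply: eq_bigr => i _; case: ltnP.
Qed.

(** Each non-[U] step closes one column, whose triangles have [j] strictly between the initial
    abscissa and the final ordinate. The additive form avoids truncated subtraction. *)
Lemma area_columns :
  area w + \sum_(k < size w | nth U w k != U) (count (predC1 U) (take k w)).+1
  = \sum_(k < size w | nth U w k != U) (count (predC1 D) (take k.+1 w)).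
Proof.
pose x k := count (predC1 U) (take k w); pose y k := count (predC1 D) (take k w).
have xS (k : 'I_(size w)) : x k.+1 = x k + (nth U w k != U).
  exact: count_takeS.
have yS (k : 'I_(size w)) : y k.+1 = y k + (nth U w k != D).
  exact: count_takeS.
have le_xy k : x k <= y k.
  by rewrite /x /y count_predC1U count_predC1D leq_add2r cprefix.
pose R (k : 'I_(size w)) i j :=
  [&& i.+1 <= j, x k == i, x k.+1 == i.+1, j <= y k & j.+1 <= y k.+1].
rewrite /area cardsE -sum_nat_pred.
rewrite (eq_bigr (fun t => \sum_k R k (val t.1) (val t.2))); last first.
  move=> [i j] _ /=; rewrite /triangle_between.
  transitivity (nat_of_bool [exists k, R k i j]).
    congr nat_of_bool; apply/andP/existsP.
      by case=> lt_ij /existsP[k kP]; exists k; rewrite /R lt_ij.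
    by case=> k /andP[lt_ij kP]; split=> //; apply/existsP; exists k.
  (* The abscissa never decreases, so a single step leads from [i] to [i.+1]. *)
  apply: sum_exists_unique => k k' /and5P[_ /eqP xk /eqP xk1 _ _].
  case/and5P=> _ /eqP xk' /eqP xk1' _ _; apply/val_inj => /=.
  case: (ltngtP k k') => // lt_k.
    by have := leq_count_take (predC1 U) w lt_k;
       rewrite -/(x _) -/(x _) xk1 xk' ltnn.
  by have := leq_count_take (predC1 U) w lt_k;
     rewrite -/(x _) -/(x _) xk1' xk ltnn.
rewrite exchange_big /= [X in X + _](_ : _ = \sum_(k < size w | nth U w k != U)
    (y k.+1 - (x k).+1)); last first.
  rewrite [RHS]big_mkcond; apply: eq_bigr => k _.
  rewrite -(pair_big xpredT xpredT (fun i j : 'I_(size w) => R k i j : nat)) /=.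
  have lt_x : x k < size w.
    apply: leq_ltn_trans (count_size _ _) _.
    by rewrite size_take ltn_ord.
  rewrite (bigD1 (Ordinal lt_x)) //= [X in _ + X]big1 ?addn0; last first.
    move=> i /negbTE i_x; rewrite big1 // => j _; rewrite /R.
    by rewrite -(inj_eq val_inj) /= eq_sym in i_x; rewrite i_x andbF.
  rewrite -(@sum_ord_interval (size w)); last first.
    apply: leq_trans (count_size _ _) _; rewrite size_take.
    by case: ifP => // _; exact: ltn_ord.
  rewrite /R eqxx /= xS yS; case: (eqVneq (nth U w k) U) => [_|w_k].
    by rewrite big1 // => j _; rewrite addn0 ltn_eqF // andbF.
  apply: eq_bigr => j _; rewrite addn1 eqxx /=; congr nat_of_bool; congr (_ && _).
  (* The two upper bounds on [j] amount to [j < y k.+1]: they coincide for [H], and the second is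
     the stronger for [D]. *)
  case: (nth U w k) w_k => //= _; rewrite ?addn0 ?addn1 ?ltnS ?andbb //.
  by apply/andP/idP => [[]//|lt_j]; split=> //; exact: ltnW.
rewrite -big_split /=; apply: eq_bigr => k w_k; rewrite subnK //.
by have := le_xy k.+1; rewrite xS w_k addn1.
Qed.

(** The initial abscissas of the non-[U] steps are 0, ..., [n + d - 1]. The ordinate of a [D] step
    is a clique entry plus 1; the [t]th [H] step ends at an independent entry plus [t], whence the
    term ['C(d, 2) + d]. *)
Lemma area_word : area w + 'C(n + d, 2) = height c + 'C(d, 2).
Proof.
have nonU : count (predC1 U) w = n + d.
  by rewrite count_predC1U cD cH.
have := area_columns.
have -> : \sum_(k < size w | nth U w k != U) (count (predC1 U) (take k w)).+1
    = 'C(n + d, 2) + (n + d).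
  rewrite (sum_count_steps (predC1 U) succn) nonU.
  under eq_bigr do rewrite -addn1; rewrite big_split /= sum1_card card_ord.
  by rewrite -(big_mkord xpredT id) bin2_sum.
have -> : \sum_(k < size w | nth U w k != U) count (predC1 D) (take k.+1 w)
    = \sum_(i < n) (c (inl i)).+1 + \sum_(j < d) c (inr j) + ('C(d, 2) + d).
  rewrite (sum_clique id) (sum_independent id).
  have := sum_count_steps (pred1 H) succn w.
  under [RHS]eq_bigr do rewrite -addn1.
  rewrite cH big_split /= sum1_card card_ord -(big_mkord xpredT id) bin2_sum => <-.
  rewrite -addnA -big_split /= [LHS]big_mkcond [X in _ = X + _]big_mkcond.
  rewrite [X in _ = _ + X]big_mkcond -big_split; apply: eq_bigr => k _ /=.
  rewrite count_takeS //; case: (nth U w k) => //=; rewrite ?addn0 //.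
  by rewrite count_predC1D add0n addn1 addnS.
under [X in _ = X + _ + _ -> _]eq_bigr do rewrite -addn1.
rewrite big_split /= sum1_card card_ord /height big_sumType /=.
move: (\sum_(i < n) _) (\sum_(j < d) _); lia.
Qed.

End Schroder.

(** Surjectivity of [phi] makes the [pick] succeed, which excludes the junk value. *)
Lemma phi_invP (n d : nat) (c : config n d) : sorted_rec c ->
  schroder n d (phi_inv c) /\ phi n d (phi_inv c) = c.
Proof.
move=> /phi_surj[p p_sch p_c]; rewrite /phi_inv.
case: pickP => [q /andP[q_sch /eqP q_c] //|nop].
have size_p : size p == n + n + d.
  by case/schroderP: p_sch => pU pD pH _; rewrite size_count pU pD pH.
by have := nop (Tuple size_p); rewrite /= p_sch p_c eqxx.
Qed.

Theorem theorem3p4 (n d : nat) (c : config n d) :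
  (1 <= n)%N -> sorted_rec c ->
  let w := mu (phi_inv c) in
  [/\ schroder n d w,
      (area w)%:Z%R = level c
    & (bounce_Sch w)%:Z%R = ((wtopple_ITC c)%:Z - (n + d)%:Z)%R].
Proof.
move=> _ c_rec w; have [p_sch p_c] := phi_invP c_rec.
have w_sch : schroder n d w := schroder_mu p_sch.
(* As [mu] is an involution, [mu w] is [phi_inv c], so the configuration attached to [w] is [c]
   itself. *)
have c_st : stable (phi n d (mu w)) by rewrite muK p_c; case: c_rec => -[].
have := area_word w_sch; have := wtopple_ITC_word w_sch c_st.
rewrite -(bounce_Sch_word w_sch) muK p_c => wtoppleE areaE.
split=> //; last by rewrite wtoppleE; lia.
rewrite /level; move: (height c) (area w) areaE; lia.
Qed.
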